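(* Let $S$ and $T$ be semigroups. The direct product $S\times T$ is completely separable if and only if both $S$ and $T$ are completely separable.
   Context: Semigroups are nonempty; $S\times T$ is the direct product with componentwise multiplication. A semigroup $S$ is completely separable if for every $s\in S$ and every subset $Y\subseteq S\setminus\{s\}$ there exist a finite semigroup $P$ and a semigroup homomorphism $\phi:S\to P$ with $\phi(s)\notin\phi(Y)$. *)

(* Defs.v *)
From mathcomp Require Import all_boot.
From mathcomp Require Import boolp classical_sets cardinality.

Set Implicit Arguments.
Unset Strict Implicit.
Unset Printing Implicit Defensive.

Local Open Scope classical_set_scope.

(* [semigroupType] bundles a choice structure with the associative law; it is
   classically available on every type and plays no role below, since both
   [set S] and [{multiplicative S -> P}] only see the multiplication.
   [semigroupType] also allows an empty carrier, so nonemptiness has to be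
   assumed where it matters; the finite target [P] here contains [phi s], hence
   is automatically nonempty. *)
Definition completely_separable (S : semigroupType) : Prop :=
  forall (s : S) (Y : set S), Y `<=` [set: S] `\ s ->
    exists (P : semigroupType) (phi : {multiplicative S -> P}),
      finite_set [set: P] /\ ~ (phi @` Y) (phi s).

(* Main.v *)
(** Complete separability of [S] says that each [s] is alone in its fibre under
    some homomorphism to a finite semigroup; equivalently, the syntactic
    congruence of [{s}] (same contexts [u _ v] evaluating to [s], with [u] and
    [v] possibly absent) has finite index.  If [phi] isolates [(s, t^3)] in
    [S * T], then padding [u], [x], [v] with [t] shows that whether [u x v = s]
    depends only on [phi (x, t)]; a one-sided context is padded with [t^2]
    instead, and the empty context is decided by [phi (x, t^3)].  So the
    syntactic congruence of [{s}] has finite index even when [T] has no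
    idempotent, i.e. when [S] need not embed in [S * T]. *)
Require Import Defs.
From HB Require Import structures.
From mathcomp Require Import all_boot.
From mathcomp Require Import boolp classical_sets cardinality.

Local Open Scope classical_set_scope.
Local Open Scope group_scope.
Local Open Scope quotient_scope.

Definition isolable {S : semigroupType} (s : S) : Prop :=
  exists (P : semigroupType) (phi : {multiplicative S -> P}),
    finite_set [set: P] /\ forall x, phi x = phi s -> x = s.

(** The complement of [s] is the largest admissible [Y], and a map separating [s] from it separates
    [s] from every smaller [Y]. *)
Lemma completely_separableP (S : semigroupType) :
  completely_separable S <-> forall s : S, isolable s.
Proof.
split=> [sepS s | isoS s Y sY].
  have [//|P [phi [finP phi_s]]] := sepS s ([set: S] `\ s).
  exists P, phi; split=> // x phi_x; apply: contrapT => x_neq_s.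
  by apply: phi_s; exists x.
have [P [phi [finP phi_s]]] := isoS s.
exists P, phi; split=> // -[x Yx /phi_s xs].
by have [_] := sY _ Yx; apply.
Qed.

(** Evaluating [h] at a chosen representative of each class embeds the quotient in [range h], even
    though [h] may take several values on one class. *)
Lemma finite_index {S : choiceType} {F : Type} (e : equiv_rel S) (h : S -> F) :
    finite_set (range h) -> (forall x y, h x = h y -> e x y) ->
  finite_set [set: {eq_quot e}].
Proof.
move=> fin_h he.
have inj_h : injective (fun q : {eq_quot e} => h (repr q)).
  by move=> p q /he/eqmodP; rewrite !reprK.
rewrite -(eq_finite_set (inj_card_eq (in2W inj_h))).
by apply: sub_finite_set fin_h => _ [q _ <-]; exists (repr q).
Qed.

Lemma isolable_congruence {S : semigroupType} (e : equiv_rel S) (s : S) :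
    (forall a x y, e x y -> e (a * x) (a * y)) ->
    (forall a x y, e x y -> e (x * a) (y * a)) ->
    finite_set [set: {eq_quot e}] -> (forall x, e x s -> x = s) ->
  isolable s.
Proof.
move=> el er fin_e e_s.
have [mul mul_pi] : exists mul : {eq_quot e} -> {eq_quot e} -> {eq_quot e},
    forall x y, mul (\pi_{eq_quot e} x) (\pi_{eq_quot e} y) =
                \pi_{eq_quot e} (x * y).
  (* Compatibility on each side replaces one representative at a time. *)
  exists (fun p q => \pi_{eq_quot e} (repr p * repr q)) => x y.
  apply/eqmodP; apply: (equiv_trans (er _ _ x _) (el _ _ _ _)).
    by apply/eqmodP; rewrite reprK.
  by apply/eqmodP; rewrite reprK.
have mulA : associative mul.
  by move=> p q r; rewrite -[p]reprK -[q]reprK -[r]reprK !mul_pi mulgA.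
pose P : semigroupType := HB.pack {eq_quot e} (isSemigroup.Build _ mulA).
pose pi (x : S) : P := \pi_{eq_quot e} x.
have piM : {morph pi : x y / x * y} by move=> x y; apply/esym/mul_pi.
pose phi : {multiplicative S -> P} :=
  HB.pack pi (isMultiplicative.Build S P pi piM).
by exists P, phi; split=> // x /eqmodP/e_s.
Qed.

(** [None] stands for the identity that would be adjoined to [S]. *)
Definition context {S : semigroupType} (u v : option S) (x : S) : S :=
  let y := if u is Some a then a * x else x in if v is Some b then y * b else y.

Definition syntactic {S : semigroupType} (s : S) : rel S :=
  fun x y => `[< forall u v, (context u v x = s) = (context u v y = s) >].

Lemma syntactic_equiv {S : semigroupType} (s : S) :
  equiv_class_of (syntactic s).
Proof.
split.
- by move=> x; apply/asboolP.
- by move=> x y; apply/asboolP/asboolP => exy u v; rewrite exy.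
- by move=> y x z /asboolP exy /asboolP eyz; apply/asboolP=> u v; rewrite exy.
Qed.

Lemma syntactic_mull {S : semigroupType} (s a x y : S) :
  syntactic s x y -> syntactic s (a * x) (a * y).
Proof.
move=> /asboolP exy; apply/asboolP => u v.
(* The factor [a] is absorbed into the left context. *)
have := exy (Some (if u is Some b then b * a else a)) v.
by case: u v => [b|] [c|]; rewrite /= ?mulgA.
Qed.

Lemma syntactic_mulr {S : semigroupType} (s a x y : S) :
  syntactic s x y -> syntactic s (x * a) (y * a).
Proof.
move=> /asboolP exy; apply/asboolP => u v.
have := exy u (Some (if v is Some b then a * b else a)).
by case: u v => [b|] [c|]; rewrite /= ?mulgA.
Qed.

Lemma isolable_fst {S T : semigroupType} (s : S) (t : T) :
  isolable (s, t * t * t) -> isolable s.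
Proof.
move=> [P [phi [finP phi_s]]].
pose e := EquivRelPack (syntactic_equiv s).
apply: (@isolable_congruence _ e).
- by move=> a x y; apply: syntactic_mull.
- by move=> a x y; apply: syntactic_mulr.
- apply: (@finite_index _ _ _ (fun x => (phi (x, t), phi (x, t * t * t)))).
    by apply: sub_finite_set (finite_setX finP finP) => -[].
  move=> x y [phi_t phi_t3]; apply/asboolP => u v.
  have phiE z : phi (z, t * t * t) = phi (s, t * t * t) <-> z = s.
    by split=> [/phi_s[]|->].
  (* Both equations now live in [P]; a nonempty context splits off a factor [(z, t)], whose image is
     the same for [x] and [y]. *)
  apply/propext; rewrite -2!phiE; case: u v => [a|] [b|] /=.
  + have E z : (a * z * b, t * t * t) = (a, t) * (z, t) * (b, t) by [].
    by rewrite !E !gmulfM phi_t.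
  + have E z : (a * z, t * t * t) = (a, t * t) * (z, t) by [].
    by rewrite !E !gmulfM phi_t.
  + have E z : (z * b, t * t * t) = (z, t) * (b, t * t).
      by rewrite -mulgA.
    by rewrite !E !gmulfM phi_t.
  + by rewrite phi_t3.
(* The empty context alone forces the class of [s] to be a singleton. *)
- by move=> x /asboolP/(_ None None)/= ->.
Qed.

Lemma isolable_pair {S T : semigroupType} (s : S) (t : T) :
  isolable s -> isolable t -> isolable (s, t).
Proof.
move=> [P [phi [finP phi_s]]] [Q [psi [finQ psi_t]]].
pose f (x : S * T) : P * Q := (phi x.1, psi x.2).
have fM : {morph f : x y / x * y} by move=> x y; rewrite /f !gmulfM.
pose F : {multiplicative S * T -> P * Q} :=
  HB.pack f (isMultiplicative.Build (S * T)%type (P * Q)%type f fM).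
exists (P * Q)%type, F; split.
  by apply: sub_finite_set (finite_setX finP finQ).
by case=> x y [/phi_s -> /psi_t ->].
Qed.

(** This symmetry lets [isolable_fst] handle the second factor too. *)
Lemma isolable_swap {S T : semigroupType} (s : S) (t : T) :
  isolable (s, t) -> isolable (t, s).
Proof.
move=> [P [phi [finP phi_st]]].
pose f (x : T * S) : P := phi (x.2, x.1).
have fM : {morph f : x y / x * y} by move=> x y; rewrite /f -gmulfM.
pose F : {multiplicative T * S -> P} :=
  HB.pack f (isMultiplicative.Build (T * S)%type P f fM).
by exists P, F; split=> // -[x y] /phi_st[-> ->].
Qed.

Theorem theorem2p3 (S T : semigroupType)
    (S_nonempty : [set: S] !=set0) (T_nonempty : [set: T] !=set0) :
  completely_separable (S * T)%type <->
  completely_separable S /\ completely_separable T.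
Proof.
rewrite !completely_separableP; split=> [isoST | [isoS isoT] [s t]].
  have [[s0 _] [t0 _]] := (S_nonempty, T_nonempty).
  split=> [s | t]; first exact: (isolable_fst _ t0).
  by apply: (isolable_fst _ s0); apply: isolable_swap.
exact: isolable_pair.
Qed.
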